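(* Let $K:\mathbb{S}^{1}\times\mathbb{S}^{1}\to\mathbb{C}$ be a continuous positive definite kernel of the form $$K(\xi,\zeta)=\sum_{j=0}^{\infty}\sum_{k=1}^{N_{j,2}}\sum_{k'=1}^{N_{j,2}}d_j(k,k')\,Y_j^k(\xi)\,\overline{Y_j^{k'}(\zeta)},\qquad \xi,\zeta\in\mathbb{S}^{1},$$ where, for each $j\ge0$, $Y_j^1,\ldots,Y_j^{N_{j,2}}$ is an orthonormal basis of the space of spherical harmonics of degree $j$ on the circle. Let $$\mathcal{F}=\{j\in\mathbb{Z}_{+}: D_j=(d_j(k,k'))_{k,k'=1}^{N_{j,2}}\text{ is a positive definite matrix}\}.$$ If $\mathcal{F}$ has non-empty intersection with every full arithmetic progression in $\mathbb{Z}_+$, then $K$ is strictly positive definite on $\mathbb{S}^1$.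
   Context: $\mathbb{S}^1$ is the unit circle in $\mathbb{R}^2$. The space of spherical harmonics of degree $j$ on $\mathbb{S}^1$ is spanned by $e^{ij\theta}$ and $e^{-ij\theta}$, where $\xi=(\cos\theta,\sin\theta)^T$; thus $N_{0,2}=1$ and $N_{j,2}=2$ for $j\ge1$. Orthonormality is in $L^2(\mathbb{S}^1)$ with arc length measure. $\mathbb{Z}_+$ denotes the nonnegative integers, and a full arithmetic progression in $\mathbb{Z}_+$ is a set $\{a+nm: m=0,1,2,\ldots\}$ with $a\in\mathbb{Z}_+$ and an integer $n\ge1$. A Hermitian kernel $K$ ($K(\xi,\zeta)=\overline{K(\zeta,\xi)}$) is called positive definite (respectively strictly positive definite) if for every finite set $\Xi$ of distinct points the matrix $(K(\xi,\zeta))_{\xi,\zeta\in\Xi}$ is positive semi-definite (respectively positive definite) on $\mathbb{C}^{|\Xi|}$. *)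

(* Defs.v *)
From HB Require Import structures.
From mathcomp Require Import all_boot all_order all_algebra.
From mathcomp Require Import all_classical all_reals all_analysis.
From mathcomp Require Import complex.

Set Implicit Arguments.
Unset Strict Implicit.
Unset Printing Implicit Defensive.

Import Order.TTheory GRing.Theory Num.Theory.
Import numFieldNormedType.Exports.

Local Open Scope classical_set_scope.
Local Open Scope ring_scope.
Local Open Scope sesquilinear_scope.

(* Functions on the circle are total functions on the plane R * R, of which
   only the restriction to [circle R] is ever constrained or used. *)

Definition circle (R : realType) : set (R * R) :=
  [set p | p.1 ^+ 2 + p.2 ^+ 2 = 1].
Arguments circle R : clear implicits.

Definition expi (R : realType) (t : R) : R[i] := (cos t +i* sin t)%C.

(* L^2 inner product for arc length measure, which is the image of Lebesgue
   measure on [0, 2 pi] under t |-> (cos t, sin t). The integral of a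
   complex function is taken through its real and imaginary parts. *)
Definition circle_dot (R : realType) (f g : R * R -> R[i]) : R[i] :=
  let h t := f (cos t, sin t) * (g (cos t, sin t))^* in
  ((\int[@lebesgue_measure R]_(t in `[0%R, pi *+ 2]) complex.Re (h t))
   +i* (\int[@lebesgue_measure R]_(t in `[0%R, pi *+ 2]) complex.Im (h t)))%C.

Definition spherical_harmonic (R : realType) (j : nat) : set (R * R -> R[i]) :=
  [set f | exists a b : R[i], forall t : R,
     f (cos t, sin t) = a * expi (j%:R * t) + b * expi (- (j%:R * t))].

(* N_{j,2}, the dimension of the space of spherical harmonics of degree j. *)
Definition Nharm (j : nat) : nat := if j is 0%N then 1%N else 2%N.

Definition orthonormal_basis (R : realType) (j : nat)
    (Y : 'I_(Nharm j) -> R * R -> R[i]) : Prop :=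
  [/\ forall k, spherical_harmonic j (Y k),
      forall k l, circle_dot (Y k) (Y l) = (k == l)%:R
    & forall f, spherical_harmonic j f ->
        exists c : 'I_(Nharm j) -> R[i],
          forall p, circle R p -> f p = \sum_k c k * Y k p].

(* In the partial order of R[i], 0 <= z and 0 < z include that z is real. *)
Definition psdefmx (R : realType) (n : nat) (A : 'M[R[i]]_n) : Prop :=
  A \is hermsymmx /\ forall v : 'cV[R[i]]_n, 0 <= (v ^t* *m A *m v) 0 0.

Definition posdefmx (R : realType) (n : nat) (A : 'M[R[i]]_n) : Prop :=
  A \is hermsymmx /\
  forall v : 'cV[R[i]]_n, v != 0 -> 0 < (v ^t* *m A *m v) 0 0.

Definition hermitian_kernel (R : realType) (K : R * R -> R * R -> R[i]) : Prop :=
  forall p q, circle R p -> circle R q -> K p q = (K q p)^*.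

(* A finite set of n distinct points is enumerated by an injection x of 'I_n;
   definiteness of the matrix does not depend on the enumeration. *)
Definition pd_kernel (R : realType) (K : R * R -> R * R -> R[i]) : Prop :=
  hermitian_kernel K /\
  forall (n : nat) (x : 'I_n -> R * R), injective x ->
    (forall a, circle R (x a)) -> psdefmx (\matrix_(a, b) K (x a) (x b)).

Definition strictly_pd_kernel (R : realType)
    (K : R * R -> R * R -> R[i]) : Prop :=
  hermitian_kernel K /\
  forall (n : nat) (x : 'I_n -> R * R), injective x ->
    (forall a, circle R (x a)) -> posdefmx (\matrix_(a, b) K (x a) (x b)).

(* R[i]^o is R[i] with the topology of its modulus. *)
Definition continuous_kernel (R : realType)
    (K : R * R -> R * R -> R[i]) : Prop :=
  {within circle R `*` circle R,
    continuous ((fun p => K p.1 p.2) : (R * R) * (R * R) -> R[i]^o)}.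

(* Pointwise convergence on the circle of the series over j. *)
Definition kernel_expansion (R : realType) (K : R * R -> R * R -> R[i])
    (Y : forall j : nat, 'I_(Nharm j) -> R * R -> R[i])
    (d : forall j : nat, 'M[R[i]]_(Nharm j)) : Prop :=
  forall p q, circle R p -> circle R q ->
    series (fun j => \sum_(k < Nharm j) \sum_(l < Nharm j)
              d j k l * Y j k p * (Y j l q)^* : R[i]^o) @ \oo
      --> (K p q : R[i]^o).

Definition full_progression (a n : nat) : set nat :=
  [set (a + n * m)%N | m in [set: nat]].

(* Main.v *)
Require Import Defs.
From mathcomp Require Import all_boot all_order all_algebra.
From mathcomp Require Import all_classical all_reals all_analysis.
From mathcomp Require Import complex closed_field mxpoly ring lra zify.

(* If v^* A v = 0 for the positive semidefinite matrix A of K at the points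
   x_b, then A v = 0, also after adding any further point p with coefficient
   0, so sum_b K(p, x_b) v_b = 0 for all p on the circle. This is an everywhere
   convergent trigonometric series with sum 0. The convergence is only
   pointwise, so it takes Cantor's uniqueness theorem (by Riemann summation and
   Schwarz's lemma) to conclude that each of its terms vanishes.
   Pairing the j-th term with v gives y^* D_j y = 0 for the moments
   y_l = sum_b v_b conj(Y_j^l(x_b)), whence y = 0 for j in F, i.e.
   sum_b conj(v_b) z_b^j = 0 with z_b the point x_b seen as a complex number.

   It remains to see that a nonzero exponential sum f(j) = sum_b w_b z_b^j is
   nonzero along a full arithmetic progression. Say f(a) != 0. The ring
   generated by the w_b and z_b has a specialization to an algebraic closure of
   a prime field F_p under which f(a) and the z_b stay nonzero. There all z_b
   are roots of unity, so f(a + N m) specializes to the same nonzero value as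
   f(a), where N is the product of their orders. *)

Set Implicit Arguments.
Unset Strict Implicit.
Unset Printing Implicit Defensive.

Import Order.TTheory GRing.Theory Num.Theory.
Import numFieldNormedType.Exports.

Local Open Scope classical_set_scope.
Local Open Scope ring_scope.

(** * Exponential sums *)

(** Remainders modulo a monic p over a finite field are finite in number, so two powers of x
    coincide; cancel the smaller one. *)
Lemma integral_torsion (F : finFieldType) (K : fieldType)
    (f : {rmorphism F -> K}) (x : K) :
  integralOver f x -> x != 0 -> exists2 n, (0 < n)%N & x ^+ n = 1.
Proof.
case=> p mon_p px x0.
pose g (i : nat) : {ffun 'I_(size p) -> F} := [ffun j => ('X^i %% p)`_(val j)].
pose N := #|{: {ffun 'I_(size p) -> F}}|.
have [i [j [ltij eqg]]] : exists i j : nat, (i < j)%N /\ g i = g j.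
  have := @leq_card _ _ (fun i : 'I_N.+1 => g i).
  rewrite card_ord ltnn => ninj; apply: contrapT => H.
  have inj : injective (fun i : 'I_N.+1 => g i).
    move=> i j eij; apply: val_inj => /=; apply: contrapT => /eqP nij; apply: H.
    by case: (ltngtP i j) nij => // lt _; [exists i, j|exists j, i].
  by have := ninj inj.
have p0 : p != 0 by rewrite monic_neq0.
have modE : 'X^i %% p = 'X^j %% p.
  apply/polyP => k; have [ltk|gek] := ltnP k (size p).
    by have /ffunP/(_ (Ordinal ltk)) := eqg; rewrite !ffunE.
  by rewrite !nth_default // (leq_trans _ gek) // ltnW // ltn_modp.
have evE m : x ^+ m = (map_poly f ('X^m %% p)).[x].
  have /(congr1 (fun q => (map_poly f q).[x])) := divp_eq 'X^m p.
  rewrite rmorphD rmorphM /= map_polyXn !hornerE (rootP px) mulr0 add0r.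
  by [].
exists (j - i)%N; first by rewrite subn_gt0.
apply: (mulfI (x := x ^+ i)); first by rewrite expf_neq0.
by rewrite mulr1 -exprD subnKC 1?ltnW // !evE modE.
Qed.

Definition torsion_field (K : fieldType) : Prop :=
  forall x : K, x != 0 -> exists2 n, (0 < n)%N & x ^+ n = 1.

(* ev presents a subring of C as a quotient of A; phi is a homomorphism from
   that subring, hence the inclusion of kernels. *)
Definition torsion_specializable (A : idomainType) (C : fieldType)
    (ev : {rmorphism A -> C}) : Prop :=
  forall b, ev b != 0 ->
    exists (K : closedFieldType) (phi : {rmorphism A -> K}),
      [/\ phi b != 0, forall a, ev a = 0 -> phi a = 0 & torsion_field K].

(** Reduction modulo a prime p > |b|, followed by an algebraic closure of F_p that is integral over
    F_p. *)
Lemma int_torsion_specializable (C : numFieldType) :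
  torsion_specializable (intmul (1 : C) : {rmorphism int -> C}).
Proof.
move=> b /=; rewrite intr_eq0 => b0.
have [p ltbp pr_p] := prime_above `|b|%N.
have [K [f fint]] := @countable_algebraic_closure 'F_p.
exists K, (intmul (1 : K) : {rmorphism int -> K}); split.
- have pK : p \in [pchar K] by rewrite (fmorph_pchar f) pchar_Fp.
  have : ((`|b|%N)%:R : K) != 0.
    rewrite -(dvdn_pcharf pK); apply/negP => /dvdn_leq.
    by rewrite absz_gt0 => /(_ b0); rewrite leqNgt ltbp.
  case: b {b0 ltbp} => n //=.
  by rewrite NegzE mulrNz oppr_eq0.
- by move=> a /eqP /=; rewrite intr_eq0 => /eqP ->.
- move=> x x0; exact: integral_torsion (fint x) x0.
Qed.

(** * Adjoining one element *)

Section Adjoin.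
Variables (A : idomainType) (C : fieldType) (ev : {rmorphism A -> C}).
Local Notation "p ^ev" := (map_poly ev p) (at level 2, format "p ^ev").

(* J is an ideal over the image of A, principal after inverting the leading
   coefficient of a generator g of least degree. *)
Lemma pseudo_principal (J : {poly C} -> Prop) (p0 : {poly A}) :
  (forall (u v : {poly A}) x y, J x -> J y -> J (u^ev * x + v^ev * y)) ->
  J p0^ev -> p0^ev != 0 ->
  exists g : {poly A}, [/\ J g^ev, ev (lead_coef g) != 0 &
    forall p, J p^ev -> exists (k : nat) (s : {poly A}),
      ev (lead_coef g ^+ k) *: p^ev = s^ev * g^ev].
Proof.
move=> Jlin Jp0 p00.
pose P n := `[< exists q : {poly A}, [/\ size q = n, J q^ev & q^ev != 0] >].
have exP : exists n, P n by exists (size p0); apply/asboolP; exists p0.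
case: (ex_minnP exP) => n /asboolP[g [sg Jg g0]] minn.
have {}minn q : J q^ev -> (size q < size g)%N -> q^ev = 0.
  move=> Jq; rewrite sg => lt; apply/eqP; apply: contraLR lt => q0.
  by rewrite -leqNgt; apply: minn; apply/asboolP; exists q.
have gn0 : g != 0 by apply: contraNneq g0 => ->; rewrite rmorph0.
have lg : ev (lead_coef g) != 0.
  apply: contraNneq g0 => lg0.
  (* Removing the leading term would give a shorter polynomial with the same image. *)
  pose h := g - lead_coef g *: 'X^((size g).-1).
  have hg : h^ev = g^ev.
    by rewrite rmorphB /= map_polyZ lg0 scale0r subr0.
  rewrite -hg; apply/eqP; apply: minn; first by rewrite hg.
  rewrite /h; have sg0 : (0 < size g)%N by rewrite size_poly_gt0.
  rewrite -[X in (_ < X)%N](prednK sg0) ltnS; apply/leq_sizeP => j.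
  rewrite leq_eqVlt => /orP[/eqP <-|ltj].
    by rewrite coefB coefZ coefXn eqxx mulr1 lead_coefE subrr.
  rewrite coefB coefZ coefXn gtn_eqF // mulr0 subr0 nth_default //.
  by rewrite -(prednK sg0).
exists g; split => // p Jp.
(* Pseudo-division stays over A; the image of the remainder lies in J and the remainder is shorter
   than g, so this image is 0. *)
have E := Pdiv.Idomain.divp_eq p g.
exists (Pdiv.IdomainDefs.scalp p g), (Pdiv.IdomainDefs.divp p g).
have /(congr1 (map_poly ev)) := E; rewrite rmorphD rmorphM /= map_polyZ /= => Ee.
rewrite Ee (minn (Pdiv.IdomainDefs.modp p g)) ?addr0 ?Pdiv.Idomain.ltn_modp //.
have -> : (Pdiv.IdomainDefs.modp p g)^ev =
  (lead_coef g ^+ Pdiv.IdomainDefs.scalp p g)%:P^ev * p^ev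
    + (- Pdiv.IdomainDefs.divp p g)^ev * g^ev.
  by rewrite map_polyC /= mul_polyC Ee rmorphN mulNr addrAC subrr add0r.
exact: (Jlin _ _ _ _ Jp Jg).
Qed.

Variable (c : C).

Definition adjoin_eval : {rmorphism {poly A} -> C} :=
  horner_morph (fun a => mulrC c (ev a)).

Lemma adjoin_evalE p : adjoin_eval p = p^ev.[c].
Proof. by []. Qed.

(** If c is transcendental over the image of A, keep the leading coefficient of the image of P
    nonzero and send X to a non-root. If c is algebraic, X has to go to a root of its minimal
    polynomial, and a Bezout identity keeps P nonzero there. *)
Lemma adjoin_torsion_specializable :
  torsion_specializable ev -> torsion_specializable adjoin_eval.
Proof.
move=> spec P; rewrite adjoin_evalE => Pc.
have [[q [q0 qc]]|trans] :=
  pselect (exists q : {poly A}, q^ev != 0 /\ q^ev.[c] = 0); last first.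
  have : P^ev != 0 by apply: contraNneq Pc => ->; rewrite horner0.
  rewrite -lead_coef_eq0 lead_coefE coef_map => /spec[K [phi [phiP kerP torK]]].
  have : map_poly phi P != 0.
    apply: contraNneq phiP => /(congr1 (fun r : {poly K} => r`_(size P^ev).-1)).
    by rewrite coef_map coef0 => ->.
  move=> /closed_nonrootP[x xP].
  exists K, (horner_morph (fun a => mulrC x (phi a)) : {rmorphism {poly A} -> K}).
  split=> // p; rewrite adjoin_evalE => pc; rewrite /= /horner_morph.
  suff -> : map_poly phi p = 0 by rewrite horner0.
  have p0 : p^ev = 0.
    by apply/eqP; apply: contraPT pc => p0 pc; apply: trans; exists p.
  apply/polyP => i; rewrite coef_map coef0; apply: kerP.
  by rewrite -coef_map p0 coef0.
(* Up to a scalar, g1 is the minimal polynomial of c, and g2 below is its gcd with P. *)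
have [|g1 [g1c lg1 g1P]] := @pseudo_principal (fun x => x.[c] = 0) q _ qc q0.
  by move=> u v x y xc yc; rewrite !hornerE xc yc !mulr0 addr0.
have g1n0 : g1^ev != 0.
  by apply: contraNneq lg1 => /polyP/(_ (size g1).-1); rewrite coef_map coef0 -lead_coefE => ->.
pose J2 x := exists u v : {poly A}, x = u^ev * P^ev + v^ev * g1^ev.
have J2g1 : J2 g1^ev by exists 0, 1; rewrite rmorph0 rmorph1 mul0r mul1r add0r.
have J2P : J2 P^ev by exists 1, 0; rewrite rmorph0 rmorph1 mul0r mul1r addr0.
have [|g2 [[u [v g2E]] lg2 g2P]] := @pseudo_principal J2 g1 _ J2g1 g1n0.
  move=> u v _ _ [u1 [v1 ->]] [u2 [v2 ->]].
  exists (u * u1 + v * u2), (u * v1 + v * v2); rewrite !rmorphD !rmorphM /=.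
  by rewrite !mulrDr !mulrDl !mulrA addrACA.
have g2c : g2^ev.[c] != 0.
  have [k [s E]] := g2P _ J2P.
  apply: contraNneq Pc => g2c.
  have := congr1 (horner^~ c) E; rewrite !hornerE g2c mulr0 => /eqP.
  by rewrite mulf_eq0 rmorphXn /= expf_eq0 (negPf lg2) andbF /= => /eqP ->.
have g2n0 : g2^ev != 0 by apply: contraNneq g2c => ->; rewrite horner0.
(* Up to scalars g1 = s g2, where s vanishes at c because g2 does not; so g1 divides s, and g2 is
   constant. *)
have sg2 : size g2^ev = 1%N.
  have [k [s E]] := g2P _ J2g1.
  have s1c : s^ev.[c] = 0.
    have := congr1 (horner^~ c) E; rewrite !hornerE g1c mulr0 => /esym/eqP.
    by rewrite mulf_eq0 (negPf g2c) orbF => /eqP.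
  have [k' [s' E']] := g1P _ s1c.
  have : (ev (lead_coef g1 ^+ k') * ev (lead_coef g2 ^+ k)) *: g1^ev
     = (s'^ev * g2^ev) * g1^ev.
    by rewrite -scalerA E scalerAl E' mulrAC.
  rewrite -mul_polyC => /(mulIf g1n0)/esym E2.
  have a0 : ev (lead_coef g1 ^+ k') * ev (lead_coef g2 ^+ k) != 0.
    by rewrite mulf_eq0 !rmorphXn /= !expf_eq0 (negPf lg1) (negPf lg2) !andbF.
  have := congr1 (fun r : {poly C} => size r) E2; rewrite size_polyC a0 => /eqP.
  by rewrite size_mul_eq1 => /andP[_ /eqP].
have g2C : g2^ev = (ev (lead_coef g2))%:P.
  have sz : size g2^ev = size g2 by rewrite size_map_poly_id0.
  by rewrite [LHS](size1_polyC _) ?sg2 // coef_map lead_coefE -sz sg2.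
(* The leading coefficient of g1 must survive to give a root x and to cancel in the kernel
   condition, that of g2 to keep u P + v g1 = g2 nonzero at x. *)
have [|K [phi [phib kerP torK]]] := spec (lead_coef g1 * lead_coef g2).
  by rewrite rmorphM mulf_neq0.
have phi0 p : p^ev = 0 -> map_poly phi p = 0.
  move=> p0; apply/polyP => i; rewrite coef_map coef0; apply: kerP.
  by rewrite -coef_map p0 coef0.
have phiE p p' : p^ev = p'^ev -> map_poly phi p = map_poly phi p'.
  move=> E; have := phi0 (p - p'); rewrite !rmorphB /= E subrr => /(_ erefl)/eqP.
  by rewrite subr_eq0 => /eqP.
move: phib; rewrite rmorphM mulf_eq0 negb_or => /andP[phi1 phi2].
have sg1 : (1 < size g1^ev)%N.
  by apply: (root_size_gt1 g1n0); apply/rootP; exact: g1c.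
have : size (map_poly phi g1) != 1%N.
  by rewrite size_map_poly_id0 // -(size_map_poly_id0 lg1) gtn_eqF.
move=> /closed_rootP[x /rootP xg1].
exists K, (horner_morph (fun a => mulrC x (phi a)) : {rmorphism {poly A} -> K}).
split=> //; rewrite /= /horner_morph.
  have := phiE (lead_coef g2)%:P (u * P + v * g1).
  rewrite map_polyC /= -g2C g2E rmorphD !rmorphM => /(_ erefl) /=.
  rewrite rmorphD !rmorphM map_polyC /= => /(congr1 (horner^~ x)).
  rewrite !hornerE xg1 mulr0 addr0 => E.
  by apply: contraNneq phi2 => P0; rewrite E P0 mulr0.
move=> p /g1P[k [s E]].
have := phiE (lead_coef g1 ^+ k *: p) (s * g1).
rewrite map_polyZ E rmorphM => /(_ erefl); rewrite map_polyZ rmorphM /=.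
move=> /(congr1 (horner^~ x)); rewrite !hornerE xg1 mulr0 => /eqP.
by rewrite mulf_eq0 rmorphXn /= expf_eq0 (negPf phi1) andbF /= => /eqP.
Qed.

End Adjoin.

Lemma finitely_generated_torsion_specializable (C : numFieldType) (s : seq C) :
  exists (A : idomainType) (ev : {rmorphism A -> C}),
    torsion_specializable ev /\ forall x, x \in s -> exists a, ev a = x.
Proof.
elim: s => [|c s [A [ev [spec gen]]]].
  by exists int, (intmul (1 : C)); split; first exact: int_torsion_specializable.
exists {poly A}, (adjoin_eval ev c); split.
  exact: adjoin_torsion_specializable.
move=> x; rewrite inE => /predU1P[->|/gen[a <-]].
  by exists 'X; rewrite adjoin_evalE map_polyX hornerX.
by exists a%:P; rewrite adjoin_evalE map_polyC hornerC.
Qed.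

(** Pair w with the polynomial that vanishes at all nodes but one, as in Lagrange interpolation. *)
Lemma exp_sum_eq0 (C : fieldType) n (z w : 'I_n -> C) : injective z ->
  (forall j : nat, \sum_b w b * z b ^+ j = 0) -> forall b, w b = 0.
Proof.
move=> inj_z wz0 a.
have wp0 (p : {poly C}) : \sum_b w b * p.[z b] = 0.
  under eq_bigr do rewrite horner_coef mulr_sumr.
  rewrite exchange_big big1 // => i _.
  under eq_bigr do rewrite mulrCA.
  by rewrite -mulr_sumr wz0 mulr0.
have := wp0 (\prod_(b | b != a) ('X - (z b)%:P)).
rewrite (bigD1 a) //= [X in _ + X]big1 ?addr0 => [|b ba].
  move/eqP; rewrite mulf_eq0 => /orP[/eqP //|].
  rewrite horner_prod => /prodf_eq0[b ba]; rewrite hornerXsubC subr_eq0.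
  by move=> /eqP/inj_z ab; rewrite ab eqxx in ba.
rewrite horner_prod (bigD1 b) //= hornerXsubC subrr mul0r mulr0 //.
Qed.

(* In a field all of whose units are roots of unity an exponential sum is
   periodic, so one nonzero value gives a progression of nonzero values. *)
Lemma exp_sum_avoids_progression (C : numFieldType) n (z w : 'I_n -> C) :
  injective z -> (forall b, z b != 0) -> (exists b, w b != 0) ->
  exists a N : nat, (1 <= N)%N /\
    forall m : nat, \sum_b w b * z b ^+ (a + N * m) != 0.
Proof.
move=> inj_z z0 [b0 wb0].
have [a fa] : exists a : nat, \sum_b w b * z b ^+ a != 0.
  apply: contrapT => H; move/eqP: wb0; apply; apply: (exp_sum_eq0 inj_z) => j.
  by apply/eqP; apply: contrapT => /negP ?; apply: H; exists j.
have [A [ev [spec gen]]] :=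
  finitely_generated_torsion_specializable (codom z ++ codom w).
have /choice[z' z'E] : forall b, exists x, ev x = z b.
  by move=> b; apply: gen; rewrite mem_cat codom_f.
have /choice[w' w'E] : forall b, exists x, ev x = w b.
  by move=> b; apply: gen; rewrite mem_cat codom_f orbT.
pose f j := \sum_b w' b * z' b ^+ j.
have fE j : ev (f j) = \sum_b w b * z b ^+ j.
  by rewrite rmorph_sum; apply: eq_bigr => b _; rewrite rmorphM rmorphXn /= z'E w'E.
have [|K [phi [phib kerP torK]]] := spec (f a * \prod_b z' b).
  rewrite rmorphM fE mulf_neq0 // rmorph_prod; apply/prodf_neq0 => b _.
  by rewrite /= z'E.
move: phib; rewrite rmorphM mulf_eq0 negb_or rmorph_prod => /andP[phif /prodf_neq0 phiz].
have /choice[N NP] : forall b, exists N, (0 < N)%N /\ phi (z' b) ^+ N = 1.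
  by move=> b; have [N] := torK _ (phiz b isT); exists N; split.
exists a, (\prod_b N b)%N; split.
  by apply/prodn_gt0 => b; case: (NP b).
move=> m; rewrite -fE; apply: contra_neq phif => /kerP <-.
rewrite !rmorph_sum; apply: eq_bigr => b _; rewrite !rmorphM !rmorphXn /=.
rewrite exprD (bigD1 b) //= -mulnA exprM (NP b).2 expr1n mulr1 //.
Qed.

(** * Cantor's uniqueness theorem *)

Section Sinc.
Variable R : realType.
Implicit Types x y : R.

Lemma sin_MVT y x : y <= x ->
  exists2 c, y <= c <= x & sin x - sin y = cos c * (x - y).
Proof.
move=> yx; have sin' z : z \in `]y, x[ -> is_derive z 1 sin (cos z).
  by move=> _; exact: is_derive_sin.
have [|c] := MVT_segment yx sin'.
  by apply: continuous_subspaceT => z; exact: continuous_sin.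
by rewrite in_itv /= => ? ?; exists c.
Qed.

Lemma cos_MVT y x : y <= x ->
  exists2 c, y <= c <= x & cos x - cos y = - sin c * (x - y).
Proof.
move=> yx; have cos' z : z \in `]y, x[ -> is_derive z 1 cos (- sin z).
  by move=> _; exact: is_derive_cos.
have [|c] := MVT_segment yx cos'.
  by apply: continuous_subspaceT => z; exact: continuous_cos.
by rewrite in_itv /= => ? ?; exists c.
Qed.

Lemma dist_sin y x : `|sin x - sin y| <= `|x - y|.
Proof.
wlog yx : x y / y <= x.
  by move=> H; have [/H//|/ltW/H] := leP y x; rewrite distrC (distrC x).
have [c _ ->] := sin_MVT yx; rewrite normrM ler_piMl //; exact: cos_max.
Qed.

Lemma dist_cos y x : `|cos x - cos y| <= `|x - y|.
Proof.
wlog yx : x y / y <= x.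
  by move=> H; have [/H//|/ltW/H] := leP y x; rewrite distrC (distrC x).
have [c _ ->] := cos_MVT yx; rewrite normrM normrN ler_piMl //; exact: sin_max.
Qed.

Lemma dist_sqr_le (a b : R) : `|a| <= 1 -> `|b| <= 1 ->
  `|a ^+ 2 - b ^+ 2| <= 2 * `|a - b|.
Proof.
move=> a1 b1; rewrite subr_sqr normrM mulrC ler_wpM2r //.
by have := ler_normD a b; lra.
Qed.

(** The value at 0 is set apart since division by 0 gives 0. *)
Definition sinc x := if x == 0 then 1 else sin x / x.

Lemma sinc_le1 x : `|sinc x| <= 1.
Proof.
rewrite /sinc; case: eqVneq => [_|x0]; first by rewrite normr1.
rewrite normrM normfV ler_pdivrMr ?normr_gt0 // mul1r.
by have := dist_sin 0 x; rewrite sin0 !subr0.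
Qed.

(** For y > 0, sin y = y cos d and sin x = sin y + (x - y) cos c with 0 <= d <= y <= c <= x. The
    difference is then (x - y)(cos c - cos d)/x, and |cos c - cos d| <= c - d <= x. *)
Lemma dist_sinc y x : 0 <= y -> y <= x -> `|sinc x - sinc y| <= x - y.
Proof.
move=> y0 yx; rewrite /sinc.
have [x0|x0] := eqVneq x 0.
  have -> : y = 0 by apply/le_anti; rewrite y0 -x0 yx.
  by rewrite eqxx !subrr normr0 x0.
have xp : 0 < x by rewrite lt_neqAle eq_sym x0 (le_trans y0).
have [->|yn0] := eqVneq y 0.
  have [c /andP[c0 cx]] := sin_MVT (ltW xp).
  rewrite sin0 !subr0 => ->; rewrite mulfK // -cos0.
  by rewrite (le_trans (dist_cos _ _)) // subr0 ger0_norm.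
have yp : 0 < y by rewrite lt_neqAle eq_sym yn0.
have [c /andP[c1 c2] E1] := sin_MVT yx.
have [d /andP[d1 d2]] := sin_MVT y0; rewrite sin0 !subr0 => E2.
have -> : sin x / x - sin y / y = (x - y) * (cos c - cos d) / x.
  have -> : sin x = sin y + cos c * (x - y) by rewrite -E1 addrC subrK.
  by rewrite E2; field; rewrite x0 yn0.
rewrite normrM normfV (gtr0_norm xp) ler_pdivrMr // normrM.
rewrite (ger0_norm (_ : 0 <= x - y)) ?subr_ge0 // ler_wpM2l ?subr_ge0 //.
rewrite (le_trans (dist_cos _ _)) // ger0_norm; lra.
Qed.

(* Dominates the total variation of sinc^2 on [x, +oo[. *)
Definition sinc_var x : R :=
  if x <= 1 then 2 * (1 - x) + 3 else 2 * x^-1 + x^-1 ^+ 2.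

Lemma sinc_var_ge0 x : 0 <= sinc_var x.
Proof.
rewrite /sinc_var; case: (leP x 1) => x1; first by lra.
have v0 : 0 <= x^-1 by rewrite invr_ge0 ltW // (lt_trans _ x1).
have := sqr_ge0 x^-1; lra.
Qed.

(** The change of sin^2 costs at most 2(x - y)/x^2 <= 2/y - 2/x, the change of 1/t^2 at most 1/y^2 -
    1/x^2. *)
Lemma dist_sinc_sqr_gt1 y x : 1 <= y -> y <= x ->
  `|sinc x ^+ 2 - sinc y ^+ 2| <=
     (2 * y^-1 + y^-1 ^+ 2) - (2 * x^-1 + x^-1 ^+ 2).
Proof.
move=> y1 yx.
have y0 : 0 < y by rewrite (lt_le_trans _ y1).
have x0 : 0 < x by rewrite (lt_le_trans y0).
rewrite /sinc !gt_eqF // !exprMn.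
have -> : sin x ^+ 2 * x^-1 ^+ 2 - sin y ^+ 2 * y^-1 ^+ 2 =
   (sin x ^+ 2 - sin y ^+ 2) * x^-1 ^+ 2 - sin y ^+ 2 * (y^-1 ^+ 2 - x^-1 ^+ 2).
  by ring.
have vyx : x^-1 <= y^-1 by rewrite lef_pV2 // posrE.
have vx0 : 0 < x^-1 by rewrite invr_gt0.
have vy0 : 0 < y^-1 by rewrite invr_gt0.
have dv : 0 <= y^-1 ^+ 2 - x^-1 ^+ 2 by rewrite subr_ge0 lerXn2r // nnegrE ltW.
rewrite (le_trans (ler_normB _ _)) // opprD addrACA lerD //.
  rewrite normrM (ger0_norm (sqr_ge0 _)).
  have H : `|sin x ^+ 2 - sin y ^+ 2| <= 2 * (x - y).
    rewrite (le_trans (dist_sqr_le (sin_max _) (sin_max _))) // ler_wpM2l //.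
    by rewrite (le_trans (dist_sin _ _)) // ger0_norm // subr_ge0.
  rewrite (le_trans (ler_wpM2r (sqr_ge0 _) H)) //.
  have -> : 2 * (x - y) * x^-1 ^+ 2 = (y * x^-1) * (2 / y - 2 / x).
    by field; rewrite !gt_eqF.
  rewrite ler_piMl // ?ler_pdivrMr ?mul1r // subr_ge0 ler_wpM2l //.
rewrite normrM (ger0_norm dv) ler_piMl // normrX.
by rewrite expr_le1 //; exact: sin_max.
Qed.

(** On [0, 1] the Lipschitz constant 2 suffices. Both formulas of [sinc_var] give 3 at 1, so an
    interval across 1 can be split there. *)
Lemma dist_sinc_sqr y x : 0 <= y -> y <= x ->
  `|sinc x ^+ 2 - sinc y ^+ 2| <= sinc_var y - sinc_var x.
Proof.
move=> y0 yx; rewrite /sinc_var.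
have small a b : 0 <= a -> a <= b ->
    `|sinc b ^+ 2 - sinc a ^+ 2| <= 2 * (b - a).
  move=> a0 ab; rewrite (le_trans (dist_sqr_le (sinc_le1 _) (sinc_le1 _))) //.
  by rewrite ler_wpM2l // dist_sinc.
have [x1|x1] := leP x 1.
  by rewrite (le_trans yx x1) (le_trans (small _ _ y0 yx)) //; lra.
have [y1|y1] := leP y 1; last by apply: dist_sinc_sqr_gt1 => //; exact: ltW.
have -> : sinc x ^+ 2 - sinc y ^+ 2 =
  (sinc x ^+ 2 - sinc 1 ^+ 2) + (sinc 1 ^+ 2 - sinc y ^+ 2) by ring.
rewrite (le_trans (ler_normD _ _)) //.
have := small _ _ y0 y1; have := dist_sinc_sqr_gt1 (lexx 1) (ltW x1).
by rewrite invr1; lra.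
Qed.

(** The bounds telescope, and 5 is [sinc_var 0]; the bound is uniform in h and N. *)
Lemma sinc_sqr_bounded_variation (h : R) N : 0 <= h ->
  \sum_(j < N) `|sinc (j%:R * h) ^+ 2 - sinc (j.+1%:R * h) ^+ 2| <= 5.
Proof.
move=> h0.
rewrite (@le_trans _ _ (\sum_(0 <= j < N)
    (sinc_var (j%:R * h) - sinc_var (j.+1%:R * h)))) //.
  rewrite big_mkord ler_sum // => j _; rewrite distrC dist_sinc_sqr //.
    by rewrite mulr_ge0.
  by rewrite ler_wpM2r // ler_nat.
rewrite (eq_big_nat _ _ (F2 := fun j : nat =>
  (fun i : nat => - sinc_var (i%:R * h)) j.+1 - (fun i => - sinc_var (i%:R * h)) j));
  last by move=> i _; rewrite opprK addrC.
rewrite telescope_sumr // opprK mul0r.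
have -> : sinc_var 0 = 5 :> R by rewrite /sinc_var ler01; ring.
have := sinc_var_ge0 (N%:R * h); lra.
Qed.

Lemma cvg_sinc_sqr (j : nat) : sinc (j%:R * (n.+1%:R)^-1) ^+ 2 @[n --> \oo] --> (1 : R).
Proof.
apply/cvgrPdist_le => e e0.
have : (n.+1%:R : R)^-1 @[n --> \oo] --> (0 : R) by exact: cvg_harmonic.
move=> /cvgrPdist_le /(_ (e / (2 * j.+1%:R))) [|N _ HN].
  by rewrite divr_gt0 // mulr_gt0.
exists N => // n /HN /=; rewrite sub0r normrN ger0_norm ?invr_ge0 // => le_e.
rewrite -[X in X - _](_ : sinc 0 ^+ 2 = 1); last by rewrite /sinc eqxx expr1n.
rewrite (le_trans (dist_sqr_le (sinc_le1 _) (sinc_le1 _))) // distrC.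
have p0 : 0 <= j%:R * n.+1%:R^-1 :> R by rewrite mulr_ge0 // invr_ge0.
rewrite (le_trans (ler_wpM2l _ (dist_sinc (lexx 0) p0))) // subr0.
apply: (@le_trans _ _ (2 * (j%:R * (e / (2 * j.+1%:R))))).
  by rewrite !ler_wpM2l.
have -> : 2 * (j%:R * (e / (2 * j.+1%:R))) = e * (j%:R / j.+1%:R).
  by field; rewrite nat1r pnatr_eq0.
by rewrite ler_piMr ?(ltW e0) // ler_pdivrMr ?ltr0n // mul1r ler_nat.
Qed.

End Sinc.

(** Summation by parts passes to the partial sums s of x. For small j the increments of c n vanish
    as n grows, since c n j tends to 1; for large j, s is small and the increments total at most
    V. *)
Lemma abel_regular (R : realType) (x : R^nat) (c : nat -> nat -> R) (V : R) :
  series x @ \oo --> 0 -> (forall n j, `|c n j| <= 1) ->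
  (forall n N, \sum_(j < N) `|c n j - c n j.+1| <= V) ->
  (forall j, c n j @[n --> \oo] --> (1 : R)) ->
  forall e, 0 < e -> \forall n \near \oo, \forall N \near \oo,
    `|\sum_(j < N) x j * c n j| <= e.
Proof.
move=> sx c1 cV climit e e0.
have V0 : 0 <= V by have := cV 0%N 0%N; rewrite big_ord0.
pose s N := \sum_(i < N) x i.
have summation n N : \sum_(j < N) x j * c n j =
    s N * c n N + \sum_(j < N) s j.+1 * (c n j - c n j.+1).
  elim: N => [|N IH]; first by rewrite /s !big_ord0 mul0r addr0.
  rewrite big_ord_recr /= IH [in RHS]big_ord_recr /= {1 3 4}/s big_ord_recr /= -/(s N).
  by rewrite [s N.+1]big_ord_recr /= -/(s N); ring.
(* The error is at most d for the boundary term, d for the head and d * V for the tail. *)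
pose d := e / (V + 2).
have d0 : 0 < d by rewrite divr_gt0 //; lra.
move/cvgrPdist_le: sx => /(_ d d0)[J _ HJ].
have sJ N : (J <= N)%N -> `|s N| <= d.
  by move=> /HJ; rewrite /= sub0r normrN /series /= big_mkord.
have : \sum_(j < J) `|s j.+1| * `|c n j - c n j.+1| @[n --> \oo]
    --> \sum_(j < J) `|s j.+1| * `|(1 : R) - 1|.
  apply: cvg_big => [|j _]; first exact: add_continuous.
  apply: cvgMl_tmp; apply: cvg_norm.
  by apply: cvgB; exact: climit.
rewrite subrr normr0 big1 => [|i _]; last by rewrite mulr0.
move=> /cvgrPdist_le/(_ d d0); apply: filterS => n.
rewrite sub0r normrN ger0_norm ?sumr_ge0 // => smalln.
exists J => // N /= JN; rewrite summation.
have split_sum : \sum_(j < N) `|s j.+1 * (c n j - c n j.+1)| <=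
  \sum_(j < J) `|s j.+1| * `|c n j - c n j.+1|
   + d * \sum_(j < N) `|c n j - c n j.+1|.
  rewrite mulr_sumr -(big_mkord xpredT (fun j => `|s j.+1 * (c n j - c n j.+1)|)).
  rewrite -(big_mkord xpredT (fun j => `|s j.+1| * `|c n j - c n j.+1|)).
  rewrite -(big_mkord xpredT (fun j => d * `|c n j - c n j.+1|)).
  rewrite (big_cat_nat _ JN) //= [X in _ <= _ + X](big_cat_nat _ JN) //=.
  rewrite addrA lerD //.
    rewrite -[leLHS]addr0 lerD ?sumr_ge0 //.
      by rewrite ler_sum // => i _; rewrite normrM.
    by move=> i _; rewrite mulr_ge0 // ltW.
  rewrite big_nat [leRHS]big_nat ler_sum // => i /andP[Ji _].
  by rewrite normrM ler_wpM2r // sJ // leqW.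
have sN : `|s N * c n N| <= d.
  rewrite normrM (le_trans (ler_wpM2l _ (c1 n N))) // mulr1 sJ //.
rewrite (le_trans (ler_normD _ _)) //.
rewrite (le_trans (lerD sN (ler_norm_sum _ _ _))) //.
rewrite (le_trans (lerD (lexx _) split_sum)) //.
have := ler_wpM2l (ltW d0) (cV n N).
have : d * (V + 2) = e by rewrite /d divfK // gt_eqF //; lra.
rewrite mulrDr; lra.
Qed.

(** * Terms of a trigonometric series *)

Section TrigSeries.
Variable R : realType.
Implicit Types (a b x : R^nat) (t s h : R) (F : R -> R).

Definition trig a b (j : nat) t := a j * cos (j%:R * t) + b j * sin (j%:R * t).

Lemma trigD a b j t s : trig a b j (t + s) =
  trig a b j t * cos (j%:R * s)
  + (b j * cos (j%:R * t) - a j * sin (j%:R * t)) * sin (j%:R * s).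
Proof. by rewrite /trig mulrDr cosD sinD; ring. Qed.

Lemma trigB a b j t s : trig a b j (t - s) =
  trig a b j t * cos (j%:R * s)
  - (b j * cos (j%:R * t) - a j * sin (j%:R * t)) * sin (j%:R * s).
Proof. by rewrite trigD mulrN cosN sinN mulrN. Qed.

Lemma trig0 a b t : trig a b 0 t = a 0%N.
Proof. by rewrite /trig mul0r cos0 sin0 mulr0 mulr1 addr0. Qed.

Lemma trig_le a b j t : `|trig a b j t| <= `|a j| + `|b j|.
Proof.
rewrite (le_trans (ler_normD _ _)) // !normrM lerD // ler_piMr //.
  exact: cos_max.
exact: sin_max.
Qed.

Lemma continuous_trig a b j : continuous (trig a b j).
Proof.
move=> t; apply: cvgD; apply: cvgMl_tmp.
  by apply: (continuous_comp _ (@continuous_cos _ _)); exact: mulrl_continuous.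
by apply: (continuous_comp _ (@continuous_sin _ _)); exact: mulrl_continuous.
Qed.

(* A nonempty interval on which all terms are bounded by N exists by Baire;
   it contains a quarter period of the j-th term once j is large. *)
Lemma trig_bounded a b : (forall t, trig a b j t @[j --> \oo] --> (0 : R)) ->
  exists2 M, 0 <= M & forall j t, `|trig a b j t| <= M.
Proof.
move=> cvg0.
pose G (N : nat) := [set t | exists j, N%:R < `|trig a b j t|].
have openG N : open (G N).
  have -> : G N = \bigcup_j (fun t => `|trig a b j t|) @^-1` [set r | N%:R < r].
    by apply/seteqP; split => t; [move=> [j ?]; exists j|move=> [j _ ?]; exists j].
  apply: bigcup_open => j _; apply: open_comp; last exact: open_gt.
  by move=> t _; apply: continuous_comp; [exact: continuous_trig|exact: norm_continuous].
have [N ndN] : exists N, ~ dense (G N).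
  apply: contrapT => /forallNP Gd.
  have /(_ setT) : dense (\bigcap_N G N).
    by apply: (@Baire R R^o) => N; split; [exact: openG|apply: contrapT; exact: Gd].
  case; [by exists 0|exact: openT|move=> t [_ tG]].
  have /cvg_seq_bounded [B [_ HB]] : cvgn (fun j => trig a b j t).
    by apply/cvg_ex; exists 0.
  have B1 : B < `|B| + 1 by rewrite (le_lt_trans (ler_norm _)) // ltrDl.
  have [j] := tG (Num.truncn (`|B| + 1)).+1 I.
  have := HB _ B1 j I => /= h1 h2.
  have := lt_le_trans h2 h1; rewrite ltNge ltW //; exact: truncnS_gt.
have [U [[c [oU cU]] UG]] := denseNE ndN.
have /nbhs_ballP[d /= d0 dU] : nbhs c U by exact: open_nbhs_nbhs.
have small j s : `|s| < d -> `|trig a b j (c + s)| <= N%:R.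
  move=> sd; rewrite leNgt; apply/negP => lt.
  have : (U `&` G N) (c + s).
    split; last by exists j.
    by apply: dU; rewrite /ball /= opprD addrA subrr sub0r normrN.
  by rewrite UG.
pose J := (Num.truncn (pi / d)).+1.
have bigj j t : (J <= j)%N -> `|trig a b j t| <= N%:R + N%:R.
  move=> Jj; have j0 : (0 < j%:R :> R) by rewrite ltr0n (leq_trans _ Jj).
  pose s : R := pi / 2 / j%:R.
  have s0 : 0 < s by rewrite /s !divr_gt0 // pi_gt0.
  have js : j%:R * s = pi / 2 by rewrite /s mulrC divfK ?gt_eqF.
  have sd : s < d.
    rewrite /s ltr_pdivrMr // mulrC.
    have := truncnS_gt (pi / d).
    rewrite ltr_pdivrMr // -/J => /lt_le_trans -/(_ (j%:R * d)).
    rewrite ler_wpM2r ?ler_nat ?ltW // => /(_ isT).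
    by have := pi_gt0 R; lra.
  have h0 := small j 0; rewrite normr0 addr0 in h0; have {}h0 := h0 d0.
  have h1 := small j s; rewrite gtr0_norm // in h1; have {}h1 := h1 sd.
  (* A shift by a quarter period turns the term into its conjugate, so both are bounded by N at c,
     and the addition formula extends the bound to all t. *)
  rewrite trigD js cos_pihalf sin_pihalf mulr0 mulr1 add0r in h1.
  have -> : t = c + (t - c) by ring.
  rewrite trigD (le_trans (ler_normD _ _)) // !normrM lerD //.
    by rewrite (le_trans _ h0) // ler_piMr //; exact: cos_max.
  by rewrite (le_trans _ h1) // ler_piMr //; exact: sin_max.
exists (N%:R + N%:R + \sum_(i < J) (`|a i| + `|b i|)).
  by rewrite !addr_ge0 // sumr_ge0.
move=> j t; have [jJ|Jj] := ltnP j J; last first.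
  by rewrite (le_trans (bigj _ _ Jj)) // lerDl sumr_ge0.
rewrite (le_trans (trig_le _ _ _ _)) // (bigD1 (Ordinal jJ)) //=.
by rewrite addrCA lerDl !addr_ge0 // sumr_ge0.
Qed.

Lemma sum_inv_sqr_le (n k : nat) : (0 < n)%N ->
  \sum_(n.+1 <= j < n.+1 + k) (j%:R ^- 2 : R) <= n%:R^-1 - (n + k)%:R^-1.
Proof.
move=> n0; elim: k => [|k IH].
  by rewrite !addn0 subrr big_geq.
rewrite addnS big_nat_recr /=; last by rewrite leq_addr.
rewrite addnS (le_trans (lerD IH (lexx _))) //.
have m0 : (0 < (n + k)%:R :> R) by rewrite ltr0n addn_gt0 n0.
rewrite addSn -addrA lerD2l -natr1; move: m0; set m : R := (n + k)%:R => m0.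
rewrite -subr_ge0.
have -> : - (m + 1)^-1 - (- m^-1 + (m + 1) ^- 2) = (m * (m + 1) ^+ 2)^-1.
  by field; rewrite !gt_eqF //; lra.
by rewrite invr_ge0 mulr_ge0 ?exprn_ge0 //; lra.
Qed.

Lemma inv_sqr_tail x M n N : (forall j, `|x j| <= M) -> (0 < n)%N ->
  `|\sum_(n.+1 <= j < N) x j / j%:R ^+ 2| <= M / n%:R.
Proof.
move=> xM n0; have M0 : 0 <= M by rewrite (le_trans _ (xM 0%N)).
have [Nn|nN] := leqP N n.+1.
  by rewrite big_geq // normr0 divr_ge0.
rewrite (le_trans (ler_norm_sum _ _ _)) //.
rewrite (@le_trans _ _ (M * \sum_(n.+1 <= j < N) (j%:R ^- 2 : R))) //.
  rewrite mulr_sumr ler_sum // => j _.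
  by rewrite normrM normfV (ger0_norm (sqr_ge0 _)) ler_wpM2r // invr_ge0 sqr_ge0.
rewrite ler_wpM2l // -(subnKC (ltnW nN)) (le_trans (sum_inv_sqr_le _ n0)) //.
by rewrite gerBl invr_ge0.
Qed.

Lemma is_cvg_series_inv_sqr x M : (forall j, `|x j| <= M) ->
  cvgn (series (fun j => x j / j%:R ^+ 2)).
Proof.
move=> xM; have M0 : 0 <= M by rewrite (le_trans _ (xM 0%N)).
(* Starting at 2 lets the tail bound apply with n = 1. *)
apply: normed_cvg; rewrite -(is_cvg_series_restrict 2).
apply: nondecreasing_is_cvgn.
  move=> m n mn; have [m2|m2] := leqP m 2.
    by rewrite /= [leLHS]big_geq // sumr_ge0.
  by rewrite /= [leRHS](big_cat_nat _ mn) 1?ltnW //= lerDl sumr_ge0.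
exists (M / 1) => _ [N _ <-] /=.
have := @inv_sqr_tail (fun j => `|x j|) M 1 N _ isT.
under eq_bigr do rewrite normrM normfV (ger0_norm (sqr_ge0 _)).
by move=> H; rewrite (le_trans (ler_norm _)) // H // => j; rewrite normr_id.
Qed.

End TrigSeries.

(** * Schwarz's lemma and Riemann summation *)

Section Uniqueness.
Variable R : realType.
Implicit Types (a b x : R^nat) (t s h : R) (F : R -> R).

(* Otherwise F minus its chord plus a small multiple of a square has an
   interior maximum, where its second difference quotient is nonpositive. *)
Lemma schwarz_midpoint_le F t k : continuous F ->
  (forall s e, 0 < e -> \forall n \near \oo,
     `|F (s + 2 * n.+1%:R^-1) + F (s - 2 * n.+1%:R^-1) - 2 * F s|
       <= e * (4 * n.+1%:R^-1 ^+ 2)) ->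
  0 < k -> 2 * F t <= F (t + k) + F (t - k).
Proof.
move=> cF F2 k0; rewrite leNgt; apply/negP => lt.
(* The slope of the chord over [t - k, t + k]. With e k^2 = gap/4 the function H below is gap/4
   lower at both ends than at t, so its maximum is interior. *)
pose al := (F (t + k) - F (t - k)) / (2 * k).
pose gap := 2 * F t - (F (t + k) + F (t - k)).
have gap0 : 0 < gap by rewrite /gap subr_gt0.
pose e := gap / (4 * k ^+ 2).
have k2 : 0 < k ^+ 2 by rewrite exprn_gt0.
have e0 : 0 < e by rewrite divr_gt0 // mulr_gt0.
have ek : e * k ^+ 2 = gap / 4 by rewrite /e; field; rewrite gt_eqF.
have ak : al * k = (F (t + k) - F (t - k)) / 2 by rewrite /al; field; rewrite gt_eqF.
pose H s := F s - al * (s - t) + e * (s - t) ^+ 2.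
have cH : continuous H.
  move=> s; apply: cvgD; first apply: cvgB; first exact: cF.
    by apply: cvgMl_tmp; apply: cvgB; [exact: cvg_id|exact: cvg_cst].
  apply: cvgMl_tmp; rewrite expr2; apply: cvgM.
    by apply: cvgB; [exact: cvg_id|exact: cvg_cst].
  by apply: cvgB; [exact: cvg_id|exact: cvg_cst].
have [||xi] := @EVT_max R H (t - k) (t + k).
- lra.
- exact: continuous_subspaceT.
rewrite in_itv /= => /andP[l1 l2] maxH.
have Ht : H t <= H xi by apply: maxH; rewrite in_itv /=; lra.
have HtE : H t = F t by rewrite /H subrr expr0n mulr0 subr0 mulr0 addr0.
have Hp : H (t + k) < H t.
  have -> : H (t + k) = F (t + k) - al * k + e * k ^+ 2.
    by rewrite /H (_ : t + k - t = k) //; ring.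
  by rewrite HtE ek ak; move: gap0; rewrite /gap; lra.
have Hm : H (t - k) < H t.
  have -> : H (t - k) = F (t - k) + al * k + e * k ^+ 2.
    by rewrite /H (_ : t - k - t = - k); ring.
  by rewrite HtE ek ak; move: gap0; rewrite /gap; lra.
have {}l1 : t - k < xi.
  rewrite lt_neqAle l1 andbT; apply/negP => /eqP E.
  by move: Hm; rewrite E ltNge Ht.
have {}l2 : xi < t + k.
  rewrite lt_neqAle l2 andbT; apply/negP => /eqP E.
  by move: Hp; rewrite -E ltNge Ht.
have F2e := F2 xi e e0.
pose m : R := Num.min (xi - (t - k)) (t + k - xi) / 2.
have m0 : 0 < m.
  by rewrite divr_gt0 // lt_min !subr_gt0 l1 l2.
have : (n.+1%:R : R)^-1 @[n --> \oo] --> (0 : R) by exact: cvg_harmonic.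
move=> /cvgrPdist_le /(_ m m0) smalln.
have [N _ HN] : \forall n \near \oo, False; last exact: (HN N (leqnn N)).
near=> n.
have h0 : 0 < n.+1%:R^-1 :> R by rewrite invr_gt0 ltr0n.
have hm : n.+1%:R^-1 <= m.
  suff : `|0 - n.+1%:R^-1| <= m by rewrite sub0r normrN gtr0_norm.
  by near: n.
have : `|F (xi + 2 * n.+1%:R^-1) + F (xi - 2 * n.+1%:R^-1) - 2 * F xi|
       <= e * (4 * n.+1%:R^-1 ^+ 2) by near: n.
move: h0 hm; set h : R := n.+1%:R^-1 => h0 hm; rewrite ler_norml => /andP[h1 _].
have m1 : m * 2 <= xi - (t - k) by rewrite /m divfK // ge_min lexx.
have m2 : m * 2 <= t + k - xi by rewrite /m divfK // ge_min lexx orbT.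
have Hp' : H (xi + 2 * h) <= H xi by apply: maxH; rewrite in_itv /=; lra.
have Hm' : H (xi - 2 * h) <= H xi by apply: maxH; rewrite in_itv /=; lra.
have eh : 0 < e * (4 * h ^+ 2) by rewrite (mulr_gt0 e0) // mulr_gt0 // exprn_gt0.
(* The square contributes 8 e h^2 and F at least -4 e h^2, so the second difference of H at its
   maximum would be positive. *)
have E : H (xi + 2 * h) + H (xi - 2 * h) - 2 * H xi =
  F (xi + 2 * h) + F (xi - 2 * h) - 2 * F xi + 2 * (e * (4 * h ^+ 2)).
  by rewrite /H; ring.
lra.
Unshelve. all: end_near. Qed.

(** The inequality is applied to F and to -F; changing the sign of k is a symmetry. *)
Lemma schwarz_midpoint F t k : continuous F ->
  (forall s e, 0 < e -> \forall n \near \oo,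
     `|F (s + 2 * n.+1%:R^-1) + F (s - 2 * n.+1%:R^-1) - 2 * F s|
       <= e * (4 * n.+1%:R^-1 ^+ 2)) ->
  F (t + k) + F (t - k) = 2 * F t.
Proof.
move=> cF F2.
wlog k0 : k / 0 < k => [wl|].
  have [/wl//|k0|<-] := ltgtP 0 k.
    by have := wl (- k); rewrite oppr_gt0 opprK addrC => ->.
  by rewrite addr0 subr0; ring.
apply/le_anti/andP; split; last exact: schwarz_midpoint_le.
suff : 2 * - F t <= - F (t + k) + - F (t - k) by lra.
apply: (@schwarz_midpoint_le (fun s => - F s)) k0.
  by move=> s; apply: cvgN; exact: cF.
move=> s e e0; apply: filterS (F2 s e e0) => n; apply: le_trans.
by rewrite -normrN le_eqVlt; apply/orP; left; apply/eqP; congr (`|_|); ring.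
Qed.

(* The second formal antiderivative of the series; the term j = 0 of the
   series below is x / 0 = 0. *)
Definition riemann_fun a b t : R :=
  a 0%N * t ^+ 2 / 2 - limn (series (fun j => trig a b j t / j%:R ^+ 2)).

Section Bounded.
Variables (a b : R^nat) (M : R).
Hypothesis trigM : forall j t, `|trig a b j t| <= M.

Let S t := limn (series (fun j => trig a b j t / j%:R ^+ 2)).

Lemma cvg_trig_inv_sqr t :
  \sum_(j < n) trig a b j t / j%:R ^+ 2 @[n --> \oo] --> S t.
Proof.
have /cvg_ex[l] := is_cvg_series_inv_sqr (fun j => trigM j t).
rewrite /S => H; rewrite (cvg_lim _ H) //.
by move: H; rewrite /series /=; under eq_fun do rewrite big_mkord.
Qed.

Lemma trig_inv_sqr_tail n t : (0 < n)%N ->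
  `|S t - \sum_(j < n.+1) trig a b j t / j%:R ^+ 2| <= M / n%:R.
Proof.
move=> n0; set s := \sum_(j < n.+1) _.
have : `|(\sum_(j < N) trig a b j t / j%:R ^+ 2) - s| @[N --> \oo] --> `|S t - s|.
  by apply: cvg_norm; apply: cvgB; [exact: cvg_trig_inv_sqr|exact: cvg_cst].
move=> /cvgr_to_le; apply; exists n.+1 => // N /= nN.
rewrite /s -!(big_mkord xpredT (fun j => trig a b j t / j%:R ^+ 2)).
by rewrite (big_cat_nat _ nN) //= addrAC subrr add0r inv_sqr_tail.
Qed.

(** The partial sums are continuous, and their tails are at most M/n uniformly in t. *)
Lemma continuous_riemann_fun : continuous (riemann_fun a b).
Proof.
have M0 : 0 <= M by rewrite (le_trans _ (trigM 0%N 0)).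
move=> t; apply: cvgB.
  apply: cvgMr_tmp; apply: cvgMl_tmp.
  by rewrite expr2; apply: cvgM; exact: cvg_id.
rewrite -/(S t); apply/cvgrPdist_le => e e0.
pose n := (Num.truncn (M / (e / 3))).+1.
have Mn : M / n%:R <= e / 3.
  have n0 : 0 < n%:R :> R by rewrite ltr0n.
  have := truncnS_gt (M / (e / 3)); rewrite -/n.
  rewrite ltr_pdivrMr ?divr_gt0 // => /ltW.
  by rewrite ler_pdivrMr // mulrC.
have : \sum_(j < n.+1) trig a b j s / j%:R ^+ 2 @[s --> t] -->
   \sum_(j < n.+1) trig a b j t / j%:R ^+ 2.
  apply: cvg_big => [|j _]; first exact: add_continuous.
  by apply: cvgMr_tmp; exact: continuous_trig.
move=> /cvgrPdist_le /(_ (e / 3)); rewrite divr_gt0 // => /(_ isT).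
apply: filterS => s le3.
have n0 : (0 < n)%N by [].
have T1 := le_trans (trig_inv_sqr_tail t n0) Mn.
have T2 := le_trans (trig_inv_sqr_tail s n0) Mn.
rewrite -/(S s); move: T1 T2 le3; rewrite !ler_norml; lra.
Qed.

(** The second difference with step 2h multiplies the j-th term by -4 sin^2(jh), which divided by
    -j^2 is 4 h^2 sinc^2(jh). That of a_0 t^2/2 is 4 h^2 a_0 and supplies the term j = 0. *)
Lemma second_difference_riemann_fun t h :
  4 * h ^+ 2 * (\sum_(j < N) trig a b j t * sinc (j%:R * h) ^+ 2) @[N --> \oo] -->
  riemann_fun a b (t + 2 * h) + riemann_fun a b (t - 2 * h)
    - 2 * riemann_fun a b t.
Proof.
pose P N s := \sum_(j < N) trig a b j s / j%:R ^+ 2.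
have : a 0%N * (4 * h ^+ 2) - (P N (t + 2 * h) + P N (t - 2 * h) - 2 * P N t)
   @[N --> \oo] --> a 0%N * (4 * h ^+ 2) - (S (t + 2 * h) + S (t - 2 * h) - 2 * S t).
  apply: cvgB; first exact: cvg_cst.
  apply: cvgB; first by apply: cvgD; exact: cvg_trig_inv_sqr.
  by apply: cvgMl_tmp; exact: cvg_trig_inv_sqr.
have -> : a 0%N * (4 * h ^+ 2) - (S (t + 2 * h) + S (t - 2 * h) - 2 * S t) =
  riemann_fun a b (t + 2 * h) + riemann_fun a b (t - 2 * h)
    - 2 * riemann_fun a b t.
  by rewrite /riemann_fun -/(S t) -/(S (t + _)) -/(S (t - _)); field.
(* The equality fails at N = 0, where the sum lacks its term j = 0 but the quadratic part is
   present. *)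
apply: cvg_trans; apply: near_eq_cvg; exists 1%N => // -[//|N] _ /=.
rewrite /P !big_ord_recl /= !trig0 expr0n invr0 !mulr0 !add0r mul0r.
rewrite /sinc eqxx expr1n mulr1 mulrDr [in LHS]mulrC; congr (_ + _).
rewrite !mulr_sumr -big_split -sumrB -sumrN /=; apply: eq_bigr => i _.
set j := bump 0 i; have j0 : j%:R != 0 :> R by rewrite pnatr_eq0.
rewrite trigD trigB; set T := trig a b j t; set T' := _ - _ * sin _.
have -> : j%:R * (2 * h) = (j%:R * h) *+ 2 by rewrite mulr2n; ring.
rewrite cos_mulr2n cos2sin2.
have [->|h0] := eqVneq h 0.
  by rewrite mulr0 sin0; field.
by rewrite mulf_eq0 (negPf j0) (negPf h0) /=; field; rewrite j0 h0.
Qed.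

End Bounded.

(* Riemann summation: the series still sums to 0 after damping by sinc^2. *)
Lemma trig_series_sinc_sqr a b :
  (forall t, series (fun j => trig a b j t) @ \oo --> (0 : R)) ->
  forall t h, h != 0 ->
    \sum_(j < N) trig a b j t * sinc (j%:R * h) ^+ 2 @[N --> \oo] --> (0 : R).
Proof.
move=> cvg0 t h h0.
have [|M M0 trigM] := @trig_bounded R a b.
  by move=> s; apply: cvg_series_cvg_0; apply/cvg_ex; exists 0.
have := @second_difference_riemann_fun a b M trigM t h.
(* The midpoint identity makes the limit zero for every h. Its hypothesis on small steps is Abel
   summation with weights sinc^2(j/(n+1)). *)
rewrite schwarz_midpoint ?subrr.
- move=> H; have c0 : 4 * h ^+ 2 != 0 by rewrite mulf_neq0 // expf_neq0.
  rewrite (_ : (fun N => _) = fun N => (4 * h ^+ 2)^-1 * (4 * h ^+ 2 *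
      \sum_(j < N) trig a b j t * sinc (j%:R * h) ^+ 2)).
    by rewrite -[X in _ --> X](mulr0 (4 * h ^+ 2)^-1); exact: cvgMl_tmp.
  by apply/funext => N; rewrite mulKf.
- exact: continuous_riemann_fun trigM.
move=> s e e0.
pose c n j : R := sinc (j%:R * n.+1%:R^-1) ^+ 2.
have c1 n j : `|c n j| <= 1 by rewrite normrX expr_le1 //; exact: sinc_le1.
have cV n N : \sum_(j < N) `|c n j - c n j.+1| <= 5.
  by apply: sinc_sqr_bounded_variation; rewrite invr_ge0.
have := abel_regular (cvg0 s) c1 cV (@cvg_sinc_sqr R) e0.
apply: filterS => n [N0 _ HN].
apply: (cvgr_to_le (cvg_norm (@second_difference_riemann_fun a b M trigM s n.+1%:R^-1))).
 exists N0 => // N /HN /= le_e.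
have h0' : 0 <= 4 * n.+1%:R^-1 ^+ 2 :> R by rewrite mulr_ge0 // sqr_ge0.
by rewrite normrM (ger0_norm h0') mulrC ler_wpM2r.
Qed.

End Uniqueness.

(** * Recovering the terms by discrete Fourier analysis *)

Section CantorUniqueness.
Variable R : realType.
Implicit Types (a b x : R^nat) (t s h : R).

Definition root_angle (N m : nat) : R := m%:R * (pi *+ 2 / N%:R).

(** Multiplied by 2 sin(al/2) the sum telescopes, and the ends cancel after l full periods; al/2 =
    pi l/N lies strictly between 0 and pi. *)
Lemma sum_cos_root_angle N l : (0 < l < N)%N ->
  \sum_(m < N) cos (l%:R * root_angle N m) = 0 :> R.
Proof.
move=> /andP[l0 lN]; pose al : R := l%:R * (pi *+ 2 / N%:R).
have N0 : 0 < N%:R :> R by rewrite ltr0n (leq_trans _ lN).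
have telescope n : 2 * sin (al / 2) * (\sum_(m < n) cos (m%:R * al)) =
    sin (n%:R * al - al / 2) + sin (al / 2).
  elim: n => [|n IH].
    by rewrite big_ord0 mulr0 mul0r add0r sinN addNr.
  rewrite big_ord_recr /= mulrDr IH.
  have -> : n.+1%:R * al - al / 2 = n%:R * al + al / 2 by rewrite -natr1; field.
  by rewrite sinB sinD; ring.
have : 0 < sin (al / 2).
  have -> : al / 2 = pi * (l%:R / N%:R) by rewrite /al; field; rewrite gt_eqF.
  rewrite sin_gt0_pi // mulr_gt0 ?divr_gt0 ?pi_gt0 ?ltr0n // ?(leq_trans _ lN) //=.
  by rewrite gtr_pMr ?pi_gt0 // ltr_pdivrMr // mul1r ltr_nat.
move=> s0; have := telescope N.
have -> : N%:R * al - al / 2 = - (al / 2) + pi *+ 2 *+ l.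
  by rewrite /al -mulr_natr; field; rewrite gt_eqF.
rewrite (periodicn (@sinD2pi R)) sinN addNr => /eqP.
rewrite mulf_eq0 mulf_eq0 (gt_eqF s0) pnatr_eq0 /= => /eqP E.
by rewrite -[RHS]E; apply: eq_bigr => m _; rewrite /root_angle mulrCA.
Qed.

(** The product cos(ky) cos(jy) splits into the frequencies j + k and |j - k|, the latter written
    [j - k + (k - j)] in truncated subtraction. Both are below N, so only frequency 0 has a nonzero
    sum. *)
Lemma sum_cos_1Bcos_root_angle N k j : (0 < j)%N -> (0 < k)%N -> (j + k < N)%N ->
  \sum_(m < N) cos (k%:R * root_angle N m) * (1 - cos (j%:R * root_angle N m))
    = if j == k then - (N%:R / 2) else 0 :> R.
Proof.
move=> j0 k0 jkN.
have -> : \sum_(m < N) cos (k%:R * root_angle N m) * (1 - cos (j%:R * root_angle N m))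
  = \sum_(m < N) cos (k%:R * root_angle N m)
    - ((\sum_(m < N) cos ((j + k)%:R * root_angle N m)) / 2
       + (\sum_(m < N) cos ((j - k + (k - j))%:R * root_angle N m)) / 2).
  rewrite !mulr_suml -big_split -sumrB /=; apply: eq_bigr => m _.
  set y := root_angle N m; rewrite natrD [(_ + k%:R) * y]mulrDl cosD.
  have -> : cos ((j - k + (k - j))%:R * y) = cos (j%:R * y - k%:R * y).
    have [jk|/ltnW kj] := leqP j k.
      have -> : (j - k + (k - j) = k - j)%N by lia.
      by rewrite natrB // mulrBl -cosN opprB.
    have -> : (j - k + (k - j) = j - k)%N by lia.
    by rewrite natrB // mulrBl.
  by rewrite cosB; field.
rewrite (@sum_cos_root_angle N k) ?(@sum_cos_root_angle N (j + k)); try lia.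
rewrite mul0r sub0r add0r; case: eqVneq => [->|jk].
  rewrite subnn; under eq_bigr do rewrite mul0r cos0.
  by rewrite sumr_const card_ord.
by rewrite sum_cos_root_angle ?mul0r ?oppr0 //; lia.
Qed.

(** Once x_0 = 0, the damped series gives sum_j w_j (1 - cos(jy)) = 0 for all y, where w_j =
    x_j/j^2. Testing against cos(ky) at the N-th roots of unity isolates w_k up to a tail of order
    1/n. *)
Theorem trig_series_unique a b :
  (forall t, series (fun j => trig a b j t) @ \oo --> (0 : R)) ->
  forall j t, trig a b j t = 0.
Proof.
move=> cvg0 k t; pose x j := trig a b j t.
have [|M M0 trigM] := @trig_bounded R a b.
  by move=> s; apply: cvg_series_cvg_0; apply/cvg_ex; exists 0.
have sinc0 := trig_series_sinc_sqr cvg0 t; rewrite -/(x _) in sinc0.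
have x0 : x 0%N = 0.
  (* As sinc(j pi) = 0 for j >= 1, h = pi leaves only the term j = 0. *)
  have /sinc0 H : pi != 0 :> R by rewrite gt_eqF ?pi_gt0.
  apply: (cvg_unique _ _ H) => //; apply: cvg_near_cst.
  exists 1%N => // -[//|N] _; rewrite big_ord_recl mul0r /sinc eqxx expr1n mulr1.
  rewrite big1 ?addr0 // => i _; rewrite mulf_eq0 pnatr_eq0 /= gt_eqF ?pi_gt0 //.
  have -> : (bump 0 i)%:R * pi = 0 + pi *+ (bump 0 i) :> R by rewrite add0r mulr_natl.
  have -> : sin (0 + pi *+ bump 0 i) = 0 :> R.
    elim: (bump 0 i) => [|n IH]; first by rewrite addr0 sin0.
    by rewrite mulrSr addrA sinDpi IH oppr0.
  by rewrite mul0r expr0n mulr0.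
have [->|k0] := posnP k; first exact: x0.
pose w j := x j / j%:R ^+ 2.
have cvgw y : \sum_(j < J) w j * (1 - cos (j%:R * y)) @[J --> \oo] --> (0 : R).
  have [->|y0] := eqVneq y 0.
    under eq_fun do under eq_bigr do rewrite mulr0 cos0 subrr mulr0.
    by under eq_fun do rewrite big1 //; exact: cvg_cst.
  (* The choice h = y/2 comes from 1 - cos(jy) = 2 sin^2(jy/2). *)
  have /sinc0 H : y / 2 != 0 by rewrite mulf_neq0.
  rewrite (_ : (fun J => _) = fun J => (y ^+ 2 / 2) *
      \sum_(j < J) x j * sinc (j%:R * (y / 2)) ^+ 2).
    by rewrite -[X in _ --> X](mulr0 (y ^+ 2 / 2)); exact: cvgMl_tmp.
  apply/funext => J; rewrite mulr_sumr; apply: eq_bigr => j _; rewrite /w.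
  have [j0|j0] := eqVneq (val j) 0%N.
    by rewrite j0 x0 !mul0r mulr0.
  have jr0 : j%:R != 0 :> R by rewrite pnatr_eq0.
  rewrite /sinc mulf_eq0 (negPf jr0) mulf_eq0 (negPf y0) invr_eq0 pnatr_eq0 /=.
  have -> : j%:R * y = (j%:R * (y / 2)) *+ 2 by rewrite mulr2n; field.
  by rewrite cos_mulr2n cos2sin2; field; rewrite y0 jr0.
have bound n : (k < n)%N -> `|w k| <= 4 * M / n%:R.
  (* This N exceeds j + k for all j <= n, so orthogonality holds exactly up to n. *)
  move=> kn; pose N := (n + k).+1.
  pose G j : R := \sum_(m < N) cos (k%:R * root_angle N m) * (1 - cos (j%:R * root_angle N m)).
  have GN j : `|G j| <= 2 * N%:R.
    have -> : 2 * N%:R = \sum_(m < N) (2 : R) by rewrite sumr_const card_ord mulr_natr.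
    rewrite (le_trans (ler_norm_sum _ _ _)) //.
    rewrite ler_sum // => m _; rewrite normrM.
    have c1 := cos_max (k%:R * root_angle N m).
    rewrite -[leRHS]mul1r ler_pM // (le_trans (ler_normB _ _)) // normr1.
    by have := cos_max (j%:R * root_angle N m); lra.
  have H : \sum_(j < J) w j * G j @[J --> \oo] --> (0 : R).
    rewrite (_ : (fun J => _) = fun J => \sum_(m < N) cos (k%:R * root_angle N m) *
        \sum_(j < J) w j * (1 - cos (j%:R * root_angle N m))).
      rewrite [X in _ --> X](_ : _ = \sum_(m < N) cos (k%:R * root_angle N m) * 0).
        apply: cvg_big => [|m _]; first exact: add_continuous.
        by apply: cvgMl_tmp; exact: cvgw.
      by rewrite big1 // => m _; rewrite mulr0.
    apply/funext => J; under [RHS]eq_bigr do rewrite mulr_sumr.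
    rewrite exchange_big; apply: eq_bigr => j _; rewrite mulr_sumr.
    by apply: eq_bigr => m _; rewrite mulrCA.
  (* The terms j <= n add up to -w_k N/2; adding w_k N/2 leaves the tail, at most 2 M N/n. *)
  have H2 : `|\sum_(j < J) w j * G j + w k * (N%:R / 2)| @[J --> \oo]
      --> `|0 + w k * (N%:R / 2)|.
    by apply: cvg_norm; apply: cvgD; [exact: H|exact: cvg_cst].
  have : `|0 + w k * (N%:R / 2)| <= M * (2 * N%:R) / n%:R.
    apply: (cvgr_to_le H2); exists n.+1 => // J /= nJ.
    rewrite -(big_mkord xpredT (fun j => w j * G j)) (big_cat_nat _ nJ) //=.
    have -> : \sum_(0 <= j < n.+1) w j * G j = - (w k * (N%:R / 2)).
      rewrite big_mkord (bigD1 (Ordinal (leqW kn))) //= /G.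
      rewrite sum_cos_1Bcos_root_angle //; last by rewrite /N; lia.
      rewrite eqxx mulrN big1 ?addr0 // => i ik.
      have [i0|i0] := posnP (val i); first by rewrite /w i0 x0 !mul0r.
      rewrite sum_cos_1Bcos_root_angle //; last by have := ltn_ord i; rewrite /N; lia.
      case: eqP => [ik'|]; last by rewrite mulr0.
      by case/eqP: ik; apply: val_inj.
    rewrite addrAC addNr add0r.
    rewrite (eq_bigr (fun j : nat => (x j * G j) / j%:R ^+ 2)) => [|j _].
      apply: inv_sqr_tail; last by lia.
      by move=> j; rewrite normrM; apply: ler_pM => //; exact: trigM.
    by rewrite /w mulrAC.
  have Np : 0 < N%:R / 2 :> R by rewrite divr_gt0 // ltr0n.
  rewrite add0r normrM (gtr0_norm Np) -ler_pdivlMr // => /le_trans; apply.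
  have n0 : n%:R != 0 :> R by rewrite pnatr_eq0; lia.
  rewrite le_eqVlt; apply/orP; left; apply/eqP.
  have : N%:R != 0 :> R by rewrite pnatr_eq0.
  by move: (N%:R : R) => r r0; field; rewrite r0 n0.
have wk0 : w k = 0.
  apply/eqP; rewrite -normr_le0 leNgt; apply/negP => w0.
  have := truncnS_gt (4 * M / `|w k|); set n := Num.truncn _ => ltn.
  have := bound (n.+1 + k).+1; rewrite ltnS leq_addl => /(_ isT).
  rewrite ler_pdivlMr ?ltr0n // leNgt => /negP; apply.
  move: ltn; rewrite ltr_pdivrMr // => /lt_le_trans; apply.
  rewrite mulrC ler_wpM2l // ler_nat; lia.
move/eqP: wk0; rewrite mulf_eq0 invr_eq0 expf_eq0 /= pnatr_eq0 gtn_eqF // orbF.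
by move/eqP.
Qed.

End CantorUniqueness.

Local Open Scope sesquilinear_scope.

(** * Kernels on the circle *)

Section PositiveSemidefinite.
Variables (R : realType).
Implicit Types (n : nat).

Lemma quad_formE n (A : 'M[R[i]]_n) (v : 'cV[R[i]]_n) :
  (v ^t* *m A *m v) 0 0 = \sum_i \sum_j (v i 0)^* * A i j * v j 0.
Proof.
rewrite !mxE; under eq_bigr do rewrite !mxE mulr_suml.
rewrite exchange_big; apply: eq_bigr => i _; apply: eq_bigr => j _.
by rewrite !mxE.
Qed.

(* Minimise s |-> q(v - s A v) over real s. *)
Lemma psdefmx_isotropic n (A : 'M[R[i]]_n) (v : 'cV[R[i]]_n) :
  psdefmx A -> (v ^t* *m A *m v) 0 0 = 0 -> A *m v = 0.
Proof.
move=> [hA psA] qv; pose w := A *m v.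
have AE : A = A ^t*.
  by have /is_hermitianmxP := hA; rewrite expr0 scale1r.
have vA : v ^t* *m A = w ^t*.
  by rewrite /w trmx_mul map_mxM {1}AE.
pose N : R[i] := (w ^t* *m w) 0 0; pose Q : R[i] := (w ^t* *m A *m w) 0 0.
have NE : N = \sum_i `|w i 0| ^+ 2.
  by rewrite /N mxE; apply: eq_bigr => i _; rewrite !mxE normCK mulrC.
have N0 : 0 <= N by rewrite NE sumr_ge0 // => i _; rewrite exprn_ge0.
have Q0 : 0 <= Q by exact: psA.
have Q1 : 0 < Q + 1 by rewrite ltr_wpDl.
have [NN|Npos] : N = 0 \/ 0 < N.
  by move: N0; rewrite le_eqVlt => /orP[/eqP<-|]; [left|right].
  apply/matrixP => i j; rewrite (ord1 j) [RHS]mxE; apply/eqP.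
  have /eqP := NN; rewrite NE psumr_eq0 => [/allP/(_ i)|k _]; last exact: exprn_ge0.
  by rewrite mem_index_enum => /(_ isT); rewrite expf_eq0 normr_eq0.
(* Since N = s (Q + 1), the form s^2 Q - 2 s N becomes -s^2 (Q + 2) < 0; the added 1 covers Q =
   0. *)
pose s : R[i] := N / (Q + 1).
have sJ : s^* = s.
  by apply/CrealP; rewrite realE divr_ge0 // ltW.
have := psA (v - s *: w).
have -> : ((v - s *: w) ^t* *m A *m (v - s *: w)) 0 0 = s ^+ 2 * Q - 2 * s * N.
  have -> : (v - s *: w) ^t* = v ^t* - s *: w ^t*.
    by apply/matrixP => i j; rewrite !mxE rmorphB rmorphM /= sJ.
  rewrite mulmxBl -scalemxAl vA mulmxBl !mulmxBr -!scalemxAl -!scalemxAr.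
  have vw : w ^t* *m v = 0.
    by apply/matrixP => i j; rewrite !ord1 -vA qv mxE.
  have entryE (X Y Z : 'M[R[i]]_1) : (X - s *: Y - (s *: Y - s *: (s *: Z))) 0 0
      = X 0 0 - s * Y 0 0 - (s * Y 0 0 - s * (s * Z 0 0)) by rewrite !mxE.
  rewrite -(mulmxA _ A v) vw entryE -/N -/Q mxE; ring.
have -> : s ^+ 2 * Q - 2 * s * N = - (s ^+ 2 * (Q + 2)).
  by rewrite /s; field; rewrite gt_eqF.
have pos : 0 < s ^+ 2 * (Q + 2).
  by rewrite mulr_gt0 ?exprn_gt0 ?divr_gt0 // ltr_wpDl.
by rewrite oppr_ge0 => /(lt_le_trans pos); rewrite ltxx.
Qed.

(** This is the row of p in A v = 0. A new p enters at index 0 with coefficient 0, which leaves the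
    quadratic form unchanged. *)
Lemma pd_kernel_isotropic (K : R * R -> R * R -> R[i]) n (x : 'I_n -> R * R)
    (v : 'cV[R[i]]_n) :
  pd_kernel K -> injective x -> (forall a, circle R (x a)) ->
  (v ^t* *m (\matrix_(a, b) K (x a) (x b)) *m v) 0 0 = 0 ->
  forall p, circle R p -> \sum_b K p (x b) * v b 0 = 0.
Proof.
move=> [_ pdK] xI xc qv p pc.
have [[a ->]|px] := pselect (exists a, p = x a).
  have /(congr1 (fun u : 'cV[R[i]]_n => u a 0)) := psdefmx_isotropic (pdK _ _ xI xc) qv.
  by rewrite !mxE => E; rewrite -[RHS]E; apply: eq_bigr => b _; rewrite mxE.
pose x' (i : 'I_n.+1) := oapp x p (unlift ord0 i).
pose v' : 'cV[R[i]]_n.+1 := \col_i oapp (fun b => v b 0) 0 (unlift ord0 i).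
have x'0 : x' ord0 = p by rewrite /x' unlift_none.
have x'S i : x' (lift ord0 i) = x i by rewrite /x' liftK.
have v'0 : v' ord0 0 = 0 by rewrite mxE unlift_none.
have v'S i : v' (lift ord0 i) 0 = v i 0 by rewrite mxE liftK.
have x'I : injective x'.
  move=> i j; case: (unliftP ord0 i) => [i'|] ->; case: (unliftP ord0 j) => [j'|] ->;
    rewrite ?x'0 ?x'S //.
  - by move/xI => ->.
  - by move=> E; case: px; exists i'.
  - by move=> E; case: px; exists j'.
have x'c i : circle R (x' i).
  by case: (unliftP ord0 i) => [i'|] ->; rewrite ?x'0 ?x'S.
have qv' : (v' ^t* *m (\matrix_(a, b) K (x' a) (x' b)) *m v') 0 0 = 0.
  rewrite quad_formE big_ord_recl v'0 conjC0 big1 => [|i _]; last by rewrite !mul0r.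
  rewrite add0r -[RHS]qv quad_formE; apply: eq_bigr => i _.
  rewrite big_ord_recl v'0 mulr0 add0r; apply: eq_bigr => j _.
  by rewrite !v'S !mxE !x'S.
have /(congr1 (fun u : 'cV[R[i]]_n.+1 => u ord0 0)) := psdefmx_isotropic (pdK _ _ x'I x'c) qv'.
rewrite !mxE big_ord_recl v'0 mulr0 add0r => E; rewrite -[RHS]E.
by apply: eq_bigr => b _; rewrite v'S mxE x'0 x'S.
Qed.

End PositiveSemidefinite.

(** * Spherical harmonics as trigonometric terms *)

Section Circle.
Variable R : realType.

Lemma circle_angle (p : R * R) : circle R p -> exists t, p = (cos t, sin t).
Proof.
case: p => x y; rewrite /circle /= => pc.
have x1 : -1 <= x <= 1.
  rewrite -ler_norml -[X in X <= _]ger0_norm // -(@expr_le1 _ 2) // ?normr_ge0 //.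
  by rewrite ger0_norm // real_normK ?num_real // -pc lerDl sqr_ge0.
have sE : sin (acos x) = `|y|.
  by rewrite sin_acos // -pc addrAC subrr add0r sqrtr_sqr.
have [y0|y0] := leP 0 y.
  by exists (acos x); rewrite acosK ?in_itv // sE ger0_norm.
by exists (- acos x); rewrite cosN sinN acosK ?in_itv // sE ltr0_norm // opprK.
Qed.

Lemma circle_cos_sin (t : R) : circle R (cos t, sin t).
Proof. by rewrite /circle /= cos2Dsin2. Qed.

Lemma expiX (t : R) j : expi t ^+ j = expi (j%:R * t).
Proof.
elim: j => [|j IH]; first by rewrite /expi mul0r cos0 sin0.
rewrite exprS IH /expi -natr1 mulrDl mul1r cosD sinD; simpc.
by congr Complex; ring.
Qed.

Lemma spherical_harmonic_sum j (I : finType) (f : I -> R * R -> R[i]) (c : I -> R[i]) :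
  (forall k, spherical_harmonic j (f k)) ->
  spherical_harmonic j (fun p => \sum_k c k * f k p).
Proof.
move=> /choice[a /choice[b fE]].
exists (\sum_k c k * a k), (\sum_k c k * b k) => t.
rewrite !mulr_suml -big_split; apply: eq_bigr => k _.
by rewrite fE mulrDr !mulrA.
Qed.

Lemma spherical_harmonic_trig j (f : R * R -> R[i]) : spherical_harmonic j f ->
  exists a b a' b' : R, forall t, f (cos t, sin t) =
    ((a * cos (j%:R * t) + b * sin (j%:R * t))
     +i* (a' * cos (j%:R * t) + b' * sin (j%:R * t)))%C.
Proof.
move=> [[p q] [[r s] fE]]; exists (p + r), (s - q), (q + s), (p - r) => t.
rewrite fE /expi cosN sinN; simpc.
by congr Complex; ring.
Qed.

Lemma cvg_complex (f : nat -> R[i]) (l : R[i]) :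
  (f : nat -> R[i]^o) @ \oo --> (l : R[i]^o) ->
  complex.Re (f n) @[n --> \oo] --> complex.Re l /\
  complex.Im (f n) @[n --> \oo] --> complex.Im l.
Proof.
move=> /cvgrPdist_le H.
have H' e : 0 < e -> \forall n \near \oo, `|l - f n| <= e%:C%C.
  by move=> e0; apply: H; rewrite ltcR.
split; apply/cvgrPdist_le => e /H'; apply: filterS => n;
  rewrite normc_def lecR; apply: le_trans.
- rewrite -sqrtr_sqr ler_wsqrtr // (_ : complex.Re (l - f n) = complex.Re l - complex.Re (f n)).
    by rewrite lerDl sqr_ge0.
  by case: l {H H'} => ? ?; case: (f n).
- rewrite -sqrtr_sqr ler_wsqrtr // (_ : complex.Im (l - f n) = complex.Im l - complex.Im (f n)).
    by rewrite lerDr sqr_ge0.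
  by case: l {H H'} => ? ?; case: (f n).
Qed.

(** Along the angle, real and imaginary parts are real trigonometric series with sum 0; uniqueness
    applies to each. *)
Lemma harmonic_series_unique (u : nat -> R * R -> R[i]) :
  (forall j, spherical_harmonic j (u j)) ->
  (forall p, circle R p -> series (fun j => u j p : R[i]^o) @ \oo --> (0 : R[i]^o)) ->
  forall j p, circle R p -> u j p = 0.
Proof.
move=> uh cvg0.
have /choice[a /choice[b /choice[a' /choice[b' uE]]]] :=
  fun j => spherical_harmonic_trig (uh j).
have cvgt t := cvg_complex (cvg0 _ (circle_cos_sin t)).
have reE t N : complex.Re (series (fun j => u j (cos t, sin t)) N) =
    series (fun j => trig a b j t) N.
  rewrite /series /=; elim: N => [|N IH]; first by rewrite !big_geq.
  by rewrite !big_nat_recr //= -IH uE; case: (\sum_(_ <= _ < _) _).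
have imE t N : complex.Im (series (fun j => u j (cos t, sin t)) N) =
    series (fun j => trig a' b' j t) N.
  rewrite /series /=; elim: N => [|N IH]; first by rewrite !big_geq.
  by rewrite !big_nat_recr //= -IH uE; case: (\sum_(_ <= _ < _) _).
have re0 : forall j t, trig a b j t = 0.
  apply: trig_series_unique => t; have [+ _] := cvgt t.
  by under eq_fun do rewrite /= reE.
have im0 : forall j t, trig a' b' j t = 0.
  apply: trig_series_unique => t; have [_ +] := cvgt t.
  by under eq_fun do rewrite /= imE.
move=> j p /circle_angle[t ->]; rewrite uE.
by have := re0 j t; have := im0 j t; rewrite /trig => -> ->.
Qed.

End Circle.

Theorem theorem5 (R : realType) (K : R * R -> R * R -> R[i])
    (Y : forall j : nat, 'I_(Nharm j) -> R * R -> R[i])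
    (d : forall j : nat, 'M[R[i]]_(Nharm j))
    (K_continuous : continuous_kernel K)
    (K_pd : pd_kernel K)
    (Y_basis : forall j : nat, orthonormal_basis (Y j))
    (K_expansion : kernel_expansion K Y d)
    (F_meets : forall a n : nat, (1 <= n)%N ->
       [set j : nat | posdefmx (d j)] `&` full_progression a n !=set0) :
  strictly_pd_kernel K.
Proof.
split; first exact: K_pd.1.
move=> n x xI xc; set A := \matrix_(a, b) _.
have psA : psdefmx A by exact: K_pd.2.
split; first exact: psA.1.
move=> v v0; rewrite lt_neqAle psA.2 andbT eq_sym; apply/eqP => qv.
have L0 := pd_kernel_isotropic K_pd xI xc qv.
pose y j : 'cV[R[i]]_(Nharm j) := \col_l \sum_b (Y j l (x b))^* * v b 0.
(* The j-th term of the expansion of sum_b K(p, x_b) v_b. *)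
pose u j p := \sum_k (d j *m y j) k 0 * Y j k p.
have uh j : spherical_harmonic j (u j).
  by apply: spherical_harmonic_sum; case: (Y_basis j).
have u0 : forall j p, circle R p -> u j p = 0.
  apply: harmonic_series_unique uh _ => p pc.
  pose f b j : R[i]^o := \sum_(k < Nharm j) \sum_(l < Nharm j)
              d j k l * Y j k p * (Y j l (x b))^*.
  have : \sum_b (series (f b) N : R[i]^o) * (v b 0 : R[i]^o) @[N --> \oo] -->
      (\sum_b (K p (x b) * v b 0) : R[i]^o).
    apply: cvg_big => [|b _]; first exact: add_continuous.
    by apply: cvgMr_tmp; exact: K_expansion.
  rewrite L0 // (_ : (fun N => _) = series (fun j => u j p : R[i]^o)) //.
  apply/funext => N.
  rewrite /series /=; under eq_bigr do rewrite mulr_suml.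
  rewrite exchange_big; apply: eq_bigr => j _; rewrite /f /u.
  under eq_bigr do rewrite mulr_suml.
  rewrite exchange_big; apply: eq_bigr => k _; rewrite mxE mulr_suml.
  under eq_bigr do rewrite mulr_suml.
  rewrite exchange_big; apply: eq_bigr => l _; rewrite mxE mulr_sumr mulr_suml.
  by apply: eq_bigr => b _; ring.
have y0 j : posdefmx (d j) -> y j = 0.
  move=> [_ pos]; apply/eqP; apply: contraT => /pos.
  suff -> : ((y j) ^t* *m d j *m y j) 0 0 = 0 by rewrite ltxx.
  rewrite -mulmxA mxE.
  (* The form of D_j at y_j equals sum_b conj(v_b) u_j(x_b). *)
  rewrite (eq_bigr (fun k => \sum_b (v b 0)^* * ((d j *m y j) k 0 * Y j k (x b)))).
    rewrite exchange_big big1 // => b _.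
    by rewrite -mulr_sumr -/(u j (x b)) u0 // mulr0.
  move=> k _; rewrite !mxE rmorph_sum mulr_suml; apply: eq_bigr => b _.
  by rewrite rmorphM /= conjCK; ring.
pose z b : R[i] := ((x b).1 +i* (x b).2)%C.
pose w b := (v b 0)^*.
have zI : injective z.
  by move=> b b' [e1 e2]; apply: xI; case: (x b) (x b') e1 e2 => ? ? [? ?] /= -> ->.
have z0 b : z b != 0.
  apply/eqP => -[z1 z2]; have := xc b; rewrite /circle /= z1 z2 expr0n addr0.
  by move/eqP; rewrite eq_sym oner_eq0.
have w0 : exists b, w b != 0.
  apply: contrapT => /forallNP w0; move/eqP: v0; apply; apply/matrixP => b i.
  rewrite (ord1 i) mxE; apply/eqP; rewrite -conjC_eq0; apply: contrapT => /negP.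
  exact: w0.
have [a [N [N1 avoid]]] := exp_sum_avoids_progression zI z0 w0.
have [j [/y0 yj [m _ jE]]] := F_meets a N N1.
have /eqP := avoid m; apply; rewrite jE.
have [_ _ span] := Y_basis j.
(* The j-th power is e^{ij theta}, hence a combination of the Y_j^k, whose pairings with w are the
   conjugate entries of [y j]. *)
have [|c cE] := span (fun p => (p.1 +i* p.2)%C ^+ j).
  by exists 1, 0 => t; rewrite mul1r mul0r addr0 -expiX.
rewrite (eq_bigr (fun b => \sum_k c k * (w b * Y j k (x b)))) => [|b _].
  rewrite exchange_big big1 // => k _; rewrite -mulr_sumr.
  have := congr1 (fun M : 'cV[R[i]]_(Nharm j) => (M k 0)^*) yj.
  rewrite !mxE conjC0 rmorph_sum => E.
  rewrite -[RHS](mulr0 (c k)); congr (_ * _); rewrite -[RHS]E.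
  apply: eq_bigr => b _.
  by rewrite rmorphM /= conjCK mulrC.
rewrite /z cE // mulr_sumr; apply: eq_bigr => k _; exact: mulrCA.
Qed.
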